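(* Let $\mathcal{M}=(d,p,\mathrm{sp}(\mathcal{M},\mathcal{D}))$ be a cartesian fibered multicategory over a category $\mathcal{I}$ with pullbacks (i.e. a fibered multicategory equipped with a cartesian structure). Then the following are equivalent: (1) $\mathcal{M}$ has algebraic products, i.e. for every object $X$ of $\mathcal{M}$ and every arrow $f:pX\to J$ in $\mathcal{I}$ there exists an algebraic product for $X$ along $f$; (2) $\mathcal{M}$ has universal products, i.e. for every object $X$ of $\mathcal{M}$ and every arrow $f:pX\to J$ in $\mathcal{I}$ there exists a universal product for $X$ along $f$; (3) $\mathcal{M}$ is stably representable.
   Context: **Fibered multicategory.** A fibered multicategory consists of: a category $\mathcal{I}$ with pullbacks; a fibration in groupoids $d:\mathcal{D}\to\mathcal{I}$ (a fibration in which all arrows of $\mathcal{D}$ are cartesian); a category $\mathcal{M}$ with the same objects as $\mathcal{D}$ and a functor $p:\mathcal{M}\to\mathcal{I}$ coinciding with $d$ on objects; and a class $\mathrm{sp}(\mathcal{M},\mathcal{D})$ of ''special squares'', as follows. A square $(f',f;b,a)$ consists of horizontal arrows $f':U\to X$ (top), $f:V\to Y$ (bottom) in $\mathcal{D}$ and vertical arrows $b:U\to V$ (left), $a:X\to Y$ (right) in $\mathcal{M}$. The squares such that $pa\circ df'=df\circ pb$ is a pullback square in $\mathcal{I}$ form a double category $\mathrm{pb}(\mathcal{M},\mathcal{D})$ under horizontal and vertical pasting. The special squares form a sub double category of it: they are closed under horizontal and vertical pasting and contain the squares $(\mathrm{id},\mathrm{id};a,a)$ for all $a$ in $\mathcal{M}$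 and $(f,f;\mathrm{id},\mathrm{id})$ for all $f$ in $\mathcal{D}$. Moreover they satisfy the unique special lifting axiom: given $a:X\to Y$ in $\mathcal{M}$, arrows $f':U\to X$ and $f:V\to Y$ in $\mathcal{D}$, and $g:dU\to dV$ in $\mathcal{I}$ such that $pa\circ df'=df\circ g$ is a pullback square, there is a unique $b:U\to V$ in $\mathcal{M}$ with $pb=g$ and $(f',f;b,a)$ special. Such a $b$ is called a reindexing of $a$ (along $f$). An arrow of $\mathcal{M}$ is vertical if $p$ sends it to an identity. A $d$-lifting of an arrow $f$ of $\mathcal{I}$ is an arrow of $\mathcal{D}$ sent to $f$ by $d$. **Cartesian structure.** A triangle $(a,b,f)$ consists of $f:X\to Y$ in $\mathcal{D}$ and $a:X\to Z$, $b:Y\to Z$ in $\mathcal{M}$ with $pb\circ df=pa$. Triangles are the morphisms $a\to b$ of a category $\mathrm{tr}(\mathcal{M},\mathcal{D})$ whose objects are the arrows of $\mathcal{M}$; the composite of $(a,b,f)$ and $(b,c,g)$ is $(a,c,gf)$, and identities are $(a,a,\mathrm{id})$. A cartesian structure on a fibered multicategory is a class of ''special triangles'' forming a subcategory of $\mathrm{tr}(\mathcal{M},\mathcal{D})$ (closed under composition and containing all identities) such that: (1) if $(a,b,f)$ is special, with $a:X\to Z$, $b:Y\to Z$, and $c:Z\to W$ is in $\mathcal{M}$, then $(ca,cb,f)$ is special; (2) (discrete opfibration) for every $a:X\to Z$ in $\mathcal{M}$, every $f:X\to Y$ in $\mathcal{D}$ and every $h:dY\to pZ$ in $\mathcal{I}$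 with $h\circ df=pa$, there is a unique $b:Y\to Z$ in $\mathcal{M}$ with $pb=h$ and $(a,b,f)$ special; (3) (Frobenius) if $(f',f;a,b)$ is a special square (with $f':X'\to Y'$, $f:X\to Y$ in $\mathcal{D}$, and $a:X'\to X$, $b:Y'\to Y$ in $\mathcal{M}$) and $(c,e,f)$ is a special triangle, then $(ca,eb,f')$ is a special triangle; (4) (Beck-Chevalley) if $(a,b,f)$ is a special triangle with $f:X\to Y$, $a:X\to Z$, $b:Y\to Z$, if $(x,g;a',a)$ and $(y,g;b',b)$ are special squares with common bottom $g:Z'\to Z$ and tops $x:X'\to X$, $y:Y'\to Y$, and if $f':X'\to Y'$ in $\mathcal{D}$ satisfies $yf'=fx$ in $\mathcal{D}$ and $pb'\circ df'=pa'$, then $(a',b',f')$ is a special triangle. **Stably representable.** $\mathcal{M}$ is representable if $p$ is an opfibration. An arrow of $\mathcal{M}$ is stably opcartesian if all its reindexings (left sides of special squares having it as right side) are $p$-opcartesian. $\mathcal{M}$ is stably representable if it is representable and every opcartesian arrow is stably opcartesian. **Universal product.** A universal product for $X$ along $f:pX\to J$ is an object $P$ with $pP=J$, a $d$-lifting $\varphi:f^*P\to P$ of $f$, and a vertical arrow $\pi:f^*P\to X$ in $\mathcal{M}$ such that: for every pullback square $h\circ f'=f\circ h'$ in $\mathcal{I}$ (with $f':L\to K$, $h':L\to pX$, $h:K\to J$), every $d$-lifting $\varphi':Q'\to Q$ of $f'$, and every arrow $\rho:Q'\to X$ in $\mathcal{M}$ with $p\rho=h'$, there is a unique pair $t:Q\to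 P$, $t':Q'\to f^*P$ of arrows of $\mathcal{M}$ over $h$ and $h'$ respectively such that $(\varphi',\varphi;t',t)$ is a special square and $\pi t'=\rho$. **Algebraic product.** An algebraic product for $X$ along $f:pX\to J$ is an object $P$ with $pP=J$, a $d$-lifting $\varphi:f^*P\to P$ of $f$, a vertical arrow $\pi:f^*P\to X$ in $\mathcal{M}$ and an arrow $u:X\to P$ in $\mathcal{M}$ with $pu=f$, such that the following two triangles are special: (i) $(u\pi,\mathrm{id}_P,\varphi)$; (ii) $(\mathrm{id}_X,\ \pi\circ f^*u,\ \Delta)$, where: $h,l:K\to pX$ are the projections of a pullback of $f$ along itself (so $fh=fl$); $\tilde h:h^*X\to X$ is a $d$-lifting of $h$; $f^*u:h^*X\to f^*P$ is the unique arrow of $\mathcal{M}$ over $l$ such that $(\tilde h,\varphi;f^*u,u)$ is special; and $\Delta:X\to h^*X$ is the unique arrow of $\mathcal{D}$ over the diagonal $pX\to K$ with $\tilde h\Delta=\mathrm{id}_X$. *)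

(* Defs.v *)
Set Implicit Arguments.
Unset Strict Implicit.
Unset Printing Implicit Defensive.

Record category : Type := Category {
  obj :> Type;
  hom : obj -> obj -> Type;
  idm : forall i : obj, hom i i;
  comp : forall i j k : obj, hom j k -> hom i j -> hom i k;
  comp_idl : forall (i j : obj) (f : hom i j), comp (idm j) f = f;
  comp_idr : forall (i j : obj) (f : hom i j), comp f (idm i) = f;
  comp_assoc : forall (i j k l : obj) (f : hom i j) (g : hom j k) (h : hom k l),
    comp h (comp g f) = comp (comp h g) f
}.

Arguments hom {c} i j.
Arguments idm {c} i.
Arguments comp {c i j k} g f.

Declare Scope cat_scope.
Open Scope cat_scope.
Notation "g ∘ f" := (comp g f) (at level 40, left associativity) : cat_scope.

(* The commutative square f p = g q, with corner [P], is a pullback. *)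
Definition is_pullback (I : category) (P A B C : I)
    (p : hom P A) (q : hom P B) (f : hom A C) (g : hom B C) : Prop :=
  f ∘ p = g ∘ q /\
  forall (T : I) (x : hom T A) (y : hom T B), f ∘ x = g ∘ y ->
    exists! u : hom T P, p ∘ u = x /\ q ∘ u = y.

Definition has_pullbacks (I : category) : Prop :=
  forall (A B C : I) (f : hom A C) (g : hom B C),
    exists (P : I) (p : hom P A) (q : hom P B), is_pullback p q f g.

(* A category equipped with a functor to [I].  The family [Ob] gives the object
   part of the functor: the objects are the pairs (i, X) with [X : Ob i], and
   such an object is sent to [i].  Hom-sets are those of the total category,
   and [over] is the action of the functor on arrows.  With this encoding, an
   object X with pX = i is a term [X : Ob i], "a is a lifting of f" is the
   equation [over a = f] in a hom-set of [I], and two categories over [I] with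
   the same [Ob] have the same objects and functors agreeing on them. *)
Record category_over (I : category) (Ob : I -> Type) : Type := CategoryOver {
  ohom : forall i j : I, Ob i -> Ob j -> Type;
  oid : forall (i : I) (X : Ob i), ohom X X;
  ocomp : forall (i j k : I) (X : Ob i) (Y : Ob j) (Z : Ob k),
    ohom Y Z -> ohom X Y -> ohom X Z;
  over : forall (i j : I) (X : Ob i) (Y : Ob j), ohom X Y -> hom i j;
  ocomp_idl : forall (i j : I) (X : Ob i) (Y : Ob j) (a : ohom X Y),
    ocomp (oid Y) a = a;
  ocomp_idr : forall (i j : I) (X : Ob i) (Y : Ob j) (a : ohom X Y),
    ocomp a (oid X) = a;
  ocomp_assoc : forall (i j k l : I) (X : Ob i) (Y : Ob j) (Z : Ob k) (W : Ob l)
    (a : ohom X Y) (b : ohom Y Z) (c : ohom Z W),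
    ocomp c (ocomp b a) = ocomp (ocomp c b) a;
  over_id : forall (i : I) (X : Ob i), over (oid X) = idm i;
  over_comp : forall (i j k : I) (X : Ob i) (Y : Ob j) (Z : Ob k)
    (b : ohom Y Z) (a : ohom X Y), over (ocomp b a) = over b ∘ over a
}.

Arguments ohom {I Ob} c {i j} X Y : rename.
Arguments oid {I Ob} c {i} X : rename.
Arguments ocomp {I Ob c i j k X Y Z} b a : rename.
Arguments over {I Ob c i j X Y} a : rename.

Notation "b ∙ a" := (ocomp b a) (at level 40, left associativity) : cat_scope.

Section CategoryOver.

Variables (I : category) (Ob : I -> Type) (C : category_over Ob).

Definition cartesian (i j : I) (X : Ob i) (Y : Ob j) (f : ohom C X Y) : Prop :=
  forall (k : I) (Z : Ob k) (g : ohom C Z Y) (w : hom k i),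
    over f ∘ w = over g ->
    exists! v : ohom C Z X, over v = w /\ f ∙ v = g.

Definition opcartesian (i j : I) (X : Ob i) (Y : Ob j) (a : ohom C X Y) : Prop :=
  forall (k : I) (Z : Ob k) (c : ohom C X Z) (w : hom j k),
    w ∘ over a = over c ->
    exists! b : ohom C Y Z, over b = w /\ b ∙ a = c.

Definition fibration : Prop :=
  forall (i j : I) (f : hom i j) (Y : Ob j),
    exists (X : Ob i) (g : ohom C X Y), over g = f /\ cartesian g.

Definition fibration_in_groupoids : Prop :=
  fibration /\
  forall (i j : I) (X : Ob i) (Y : Ob j) (f : ohom C X Y), cartesian f.

Definition opfibration : Prop :=
  forall (i j : I) (f : hom i j) (X : Ob i),
    exists (Y : Ob j) (a : ohom C X Y), over a = f /\ opcartesian a.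

End CategoryOver.

(* [sp f' f b a] says that the square with top f', bottom f, left side b and
   right side a is special. *)
Record fibered_multicategory (I : category) : Type := FiberedMulticategory {
  fob : I -> Type;
  catD : category_over fob;
  catM : category_over fob;
  catD_fibration : fibration_in_groupoids catD;
  sp : forall (i j k l : I) (U : fob i) (X : fob j) (V : fob k) (Y : fob l),
    ohom catD U X -> ohom catD V Y -> ohom catM U V -> ohom catM X Y -> Prop;
  sp_pullback : forall (i j k l : I)
    (U : fob i) (X : fob j) (V : fob k) (Y : fob l)
    (f' : ohom catD U X) (f : ohom catD V Y)
    (b : ohom catM U V) (a : ohom catM X Y),
    sp f' f b a -> is_pullback (over f') (over b) (over a) (over f);
  sp_hcomp : forall (i j k l m n : I) (U : fob i) (X : fob j) (S : fob k)
    (V : fob l) (Y : fob m) (T : fob n)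
    (f' : ohom catD U X) (f : ohom catD V Y)
    (g' : ohom catD X S) (g : ohom catD Y T)
    (a : ohom catM U V) (b : ohom catM X Y) (c : ohom catM S T),
    sp f' f a b -> sp g' g b c -> sp (g' ∙ f') (g ∙ f) a c;
  sp_vcomp : forall (i j k l m n : I) (U : fob i) (X : fob j)
    (V : fob k) (Y : fob l) (W : fob m) (Z : fob n)
    (f : ohom catD U X) (g : ohom catD V Y) (h : ohom catD W Z)
    (b : ohom catM U V) (a : ohom catM X Y)
    (b' : ohom catM V W) (a' : ohom catM Y Z),
    sp f g b a -> sp g h b' a' -> sp f h (b' ∙ b) (a' ∙ a);
  sp_hid : forall (i j : I) (X : fob i) (Y : fob j) (a : ohom catM X Y),
    sp (oid catD X) (oid catD Y) a a;
  sp_vid : forall (i j : I) (X : fob i) (Y : fob j) (f : ohom catD X Y),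
    sp f f (oid catM X) (oid catM Y);
  sp_lift : forall (i j k l : I)
    (U : fob i) (X : fob j) (V : fob k) (Y : fob l)
    (f' : ohom catD U X) (f : ohom catD V Y) (a : ohom catM X Y) (g : hom i k),
    is_pullback (over f') g (over a) (over f) ->
    exists! b : ohom catM U V, over b = g /\ sp f' f b a
}.

Arguments fob {I} f i : rename.
Arguments catD {I} f : rename.
Arguments catM {I} f : rename.
Arguments sp {I f i j k l U X V Y} f' f b a : rename.

(* [sptri a b f] says that the triangle (a, b, f), with pb df = pa, is special. *)
Record cartesian_structure (I : category) (M : fibered_multicategory I) : Type :=
CartesianStructure {
  sptri : forall (i j k : I) (X : fob M i) (Y : fob M j) (Z : fob M k),
    ohom (catM M) X Z -> ohom (catM M) Y Z -> ohom (catD M) X Y -> Prop;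
  sptri_over : forall (i j k : I) (X : fob M i) (Y : fob M j) (Z : fob M k)
    (a : ohom (catM M) X Z) (b : ohom (catM M) Y Z) (f : ohom (catD M) X Y),
    sptri a b f -> over b ∘ over f = over a;
  sptri_id : forall (i k : I) (X : fob M i) (Z : fob M k)
    (a : ohom (catM M) X Z), sptri a a (oid (catD M) X);
  sptri_comp : forall (i j k l : I)
    (X : fob M i) (Y : fob M j) (W : fob M k) (Z : fob M l)
    (a : ohom (catM M) X Z) (b : ohom (catM M) Y Z) (c : ohom (catM M) W Z)
    (f : ohom (catD M) X Y) (g : ohom (catD M) Y W),
    sptri a b f -> sptri b c g -> sptri a c (g ∙ f);
  sptri_postcomp : forall (i j k l : I)
    (X : fob M i) (Y : fob M j) (Z : fob M k) (W : fob M l)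
    (a : ohom (catM M) X Z) (b : ohom (catM M) Y Z) (f : ohom (catD M) X Y)
    (c : ohom (catM M) Z W),
    sptri a b f -> sptri (c ∙ a) (c ∙ b) f;
  sptri_opfib : forall (i j k : I) (X : fob M i) (Y : fob M j) (Z : fob M k)
    (a : ohom (catM M) X Z) (f : ohom (catD M) X Y) (h : hom j k),
    h ∘ over f = over a ->
    exists! b : ohom (catM M) Y Z, over b = h /\ sptri a b f;
  sptri_frobenius : forall (i' j' i j k : I)
    (X' : fob M i') (Y' : fob M j') (X : fob M i) (Y : fob M j) (Z : fob M k)
    (f' : ohom (catD M) X' Y') (f : ohom (catD M) X Y)
    (a : ohom (catM M) X' X) (b : ohom (catM M) Y' Y)
    (c : ohom (catM M) X Z) (e : ohom (catM M) Y Z),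
    sp f' f a b -> sptri c e f -> sptri (c ∙ a) (e ∙ b) f';
  sptri_beck_chevalley : forall (i j k i' j' k' : I)
    (X : fob M i) (Y : fob M j) (Z : fob M k)
    (X' : fob M i') (Y' : fob M j') (Z' : fob M k')
    (f : ohom (catD M) X Y) (a : ohom (catM M) X Z) (b : ohom (catM M) Y Z)
    (g : ohom (catD M) Z' Z) (x : ohom (catD M) X' X) (y : ohom (catD M) Y' Y)
    (a' : ohom (catM M) X' Z') (b' : ohom (catM M) Y' Z')
    (f' : ohom (catD M) X' Y'),
    sptri a b f -> sp x g a' a -> sp y g b' b ->
    y ∙ f' = f ∙ x -> over b' ∘ over f' = over a' -> sptri a' b' f'
}.

Arguments sptri {I M} c {i j k X Y Z} a b f : rename.

Section Products.

Variables (I : category) (M : fibered_multicategory I).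

Definition representable : Prop := opfibration (catM M).

Definition stably_opcartesian (i j : I) (X : fob M i) (Y : fob M j)
    (a : ohom (catM M) X Y) : Prop :=
  forall (k l : I) (U : fob M k) (V : fob M l)
    (f' : ohom (catD M) U X) (f : ohom (catD M) V Y) (b : ohom (catM M) U V),
    sp f' f b a -> opcartesian b.

Definition stably_representable : Prop :=
  representable /\
  forall (i j : I) (X : fob M i) (Y : fob M j) (a : ohom (catM M) X Y),
    opcartesian a -> stably_opcartesian a.

Definition is_universal_product (i j : I) (X : fob M i) (f : hom i j)
    (P : fob M j) (fP : fob M i)
    (phi : ohom (catD M) fP P) (pi : ohom (catM M) fP X) : Prop :=
  over phi = f /\ over pi = idm i /\
  forall (K L : I) (f' : hom L K) (h' : hom L i) (h : hom K j),
    is_pullback f' h' h f ->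
    forall (Q : fob M K) (Q' : fob M L) (phi' : ohom (catD M) Q' Q),
      over phi' = f' ->
      forall rho : ohom (catM M) Q' X, over rho = h' ->
        exists! t : ohom (catM M) Q P * ohom (catM M) Q' fP,
          over (fst t) = h /\ over (snd t) = h' /\
          sp phi' phi (snd t) (fst t) /\ pi ∙ snd t = rho.

Definition has_universal_products : Prop :=
  forall (i : I) (X : fob M i) (j : I) (f : hom i j),
    exists (P : fob M j) (fP : fob M i)
      (phi : ohom (catD M) fP P) (pi : ohom (catM M) fP X),
      is_universal_product f phi pi.

(* The second triangle depends on auxiliary choices, each determined up to
   (unique) isomorphism: a pullback (h, l) of f along itself, its diagonal
   delta, a lifting h~ = [ht] of h, the reindexing f^*u = [fu], and
   [Delta].  It is required for all of them; they exist as soon as I has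
   pullbacks. *)
Definition is_algebraic_product (T : cartesian_structure M)
    (i j : I) (X : fob M i) (f : hom i j) (P : fob M j) (fP : fob M i)
    (phi : ohom (catD M) fP P) (pi : ohom (catM M) fP X)
    (u : ohom (catM M) X P) : Prop :=
  over phi = f /\ over pi = idm i /\ over u = f /\
  sptri T (u ∙ pi) (oid (catM M) P) phi /\
  forall (K : I) (h l : hom K i), is_pullback h l f f ->
    forall (hX : fob M K) (ht : ohom (catD M) hX X), over ht = h ->
    forall fu : ohom (catM M) hX fP, over fu = l -> sp ht phi fu u ->
    forall delta : hom i K, h ∘ delta = idm i -> l ∘ delta = idm i ->
    forall Delta : ohom (catD M) X hX,
      over Delta = delta -> ht ∙ Delta = oid (catD M) X ->
      sptri T (oid (catM M) X) (pi ∙ fu) Delta.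

Definition has_algebraic_products (T : cartesian_structure M) : Prop :=
  forall (i : I) (X : fob M i) (j : I) (f : hom i j),
    exists (P : fob M j) (fP : fob M i)
      (phi : ohom (catD M) fP P) (pi : ohom (catM M) fP X)
      (u : ohom (catM M) X P),
      is_algebraic_product T f phi pi u.

End Products.

(* Main.v *)
(** Write [phi_! a] for the arrow given by the opfibration property of special
    triangles.  The triangle (i) of an algebraic product [(P, phi, pi, u)] gives,
    by Frobenius, [t = phi'_! (u rho)] whenever [t] corresponds to [rho] under
    the universal property, and [b = phi_! (c pi)] whenever [b u = c]; so the
    existence part of both universal properties is forced, and the triangle (ii),
    which exhibits [pi f^*u] as [Delta_! id], shows that these candidates work.
    Conversely, a universal product turns [Delta_! id] into [u], and an
    opcartesian [u] whose reindexing [f^*u] is opcartesian turns it into [pi].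
    Algebraic products, being defined by special triangles, are stable under
    reindexing by Beck-Chevalley, hence so are opcartesian arrows. *)

From Corelib Require Import ssreflect.
Require Import Defs.

Set Implicit Arguments.
Unset Strict Implicit.
Unset Printing Implicit Defensive.

(** * Pullback squares in the base category *)

Lemma pullback_ext (I : category) (P A B C : I) (p : hom P A) (q : hom P B)
    (f : hom A C) (g : hom B C) (S : I) (v w : hom S P) :
  is_pullback p q f g -> p ∘ v = p ∘ w -> q ∘ v = q ∘ w -> v = w.
Proof.
move=> [E univ] Ep Eq.
have [|x [_ uniq]] := univ S (p ∘ w) (q ∘ w); first by rewrite !comp_assoc E.
by rewrite -(uniq v) // -(uniq w).
Qed.

Lemma pullback_cancel (I : category) (A B C A' B' C' : I)
    (t1 : hom A B) (t2 : hom B C) (l : hom A A') (m : hom B B') (r : hom C C')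
    (b1 : hom A' B') (b2 : hom B' C') :
  is_pullback t2 m r b2 -> is_pullback (t2 ∘ t1) l r (b2 ∘ b1) ->
  m ∘ t1 = b1 ∘ l -> is_pullback t1 l m b1.
Proof.
move=> pb2 [_ univ] E; split=> // S x y Exy.
have [|v [[Ev1 Ev2] uniq]] := univ S (t2 ∘ x) y.
  by rewrite comp_assoc (proj1 pb2) -!comp_assoc Exy.
exists v; split; last first.
  by move=> w [Ew1 Ew2]; apply: uniq; rewrite -comp_assoc Ew1.
split=> //; apply: (pullback_ext pb2); first by rewrite comp_assoc.
by rewrite comp_assoc E -comp_assoc Ev2.
Qed.

(** * Lifting and cancellation for arrows of [catD] and special squares *)

Section FiberedMulticategory.

Variables (I : category) (M : fibered_multicategory I).

Lemma catD_cleavage (i j : I) (f : hom i j) (Y : fob M j) :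
  exists (X : fob M i) (g : ohom (catD M) X Y), over g = f.
Proof.
by have [X [g [Eg _]]] := proj1 (catD_fibration M) i j f Y; exists X, g.
Qed.

Lemma catD_lift (i j k : I) (X : fob M i) (Y : fob M j) (Z : fob M k)
    (f : ohom (catD M) X Y) (g : ohom (catD M) Z Y) (w : hom k i) :
  over f ∘ w = over g ->
  exists v : ohom (catD M) Z X, over v = w /\ f ∙ v = g.
Proof.
by move=> /(proj2 (catD_fibration M) _ _ _ _ f) [v [Ev _]]; exists v.
Qed.

Lemma catD_ext (i j k : I) (X : fob M i) (Y : fob M j) (Z : fob M k)
    (f : ohom (catD M) X Y) (v w : ohom (catD M) Z X) :
  over v = over w -> f ∙ v = f ∙ w -> v = w.
Proof.
move=> Eo E.
have [|x [_ uniq]] := proj2 (catD_fibration M) _ _ _ _ f _ _ (f ∙ w) (over w).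
  by rewrite over_comp.
by rewrite -(uniq v) // -(uniq w).
Qed.

Lemma sp_exists (i j k l : I) (U : fob M i) (X : fob M j) (V : fob M k)
    (Y : fob M l) (f' : ohom (catD M) U X) (f : ohom (catD M) V Y)
    (a : ohom (catM M) X Y) (g : hom i k) :
  is_pullback (over f') g (over a) (over f) ->
  exists b : ohom (catM M) U V, over b = g /\ sp f' f b a.
Proof. by move=> /sp_lift [b [Eb _]]; exists b. Qed.

Lemma sp_unique (i j k l : I) (U : fob M i) (X : fob M j) (V : fob M k)
    (Y : fob M l) (f' : ohom (catD M) U X) (f : ohom (catD M) V Y)
    (a : ohom (catM M) X Y) (b c : ohom (catM M) U V) :
  sp f' f b a -> sp f' f c a -> over b = over c -> b = c.
Proof.
move=> sb sc E; have [x [_ uniq]] := sp_lift (sp_pullback sb).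
by rewrite -(uniq b) // -(uniq c).
Qed.

(** The left square lies over a pullback by cancellation in [I], so it has a special lift over
    [over a]. Pasting that lift with the right square identifies it with [a], by uniqueness of
    reindexings. *)
Lemma sp_cancel (i j k l m n : I) (U : fob M i) (X : fob M j) (S : fob M k)
    (V : fob M l) (Y : fob M m) (Z : fob M n)
    (f' : ohom (catD M) U X) (f : ohom (catD M) V Y)
    (g' : ohom (catD M) X S) (g : ohom (catD M) Y Z)
    (a : ohom (catM M) U V) (b : ohom (catM M) X Y) (c : ohom (catM M) S Z) :
  sp g' g b c -> sp (g' ∙ f') (g ∙ f) a c ->
  over b ∘ over f' = over f ∘ over a -> sp f' f a b.
Proof.
move=> sg sgf E.
have [|a' [Ea sa]] := @sp_exists _ _ _ _ _ _ _ _ f' f b (over a).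
  apply: (pullback_cancel (sp_pullback sg)) => //.
  by move: (sp_pullback sgf); rewrite !over_comp.
by rewrite (sp_unique sgf (sp_hcomp sa sg)).
Qed.

(* [Delta] is the diagonal of the kernel pair formed by [over ht] and [over fu]
   when [phi] and [u] lie over the same arrow. *)
Definition diagonal (i j k : I) (X : fob M i) (P : fob M j) (fP : fob M i)
    (hX : fob M k) (phi : ohom (catD M) fP P) (u : ohom (catM M) X P)
    (ht : ohom (catD M) hX X) (fu : ohom (catM M) hX fP)
    (Delta : ohom (catD M) X hX) : Prop :=
  sp ht phi fu u /\ over fu ∘ over Delta = idm i /\ ht ∙ Delta = oid (catD M) X.

Lemma diagonal_exists (hI : has_pullbacks I) (i j : I) (X : fob M i)
    (P : fob M j) (fP : fob M i) (phi : ohom (catD M) fP P)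
    (u : ohom (catM M) X P) :
  over phi = over u ->
  exists (k : I) (hX : fob M k) (ht : ohom (catD M) hX X)
    (fu : ohom (catM M) hX fP) (Delta : ohom (catD M) X hX),
    diagonal phi u ht fu Delta.
Proof.
move=> E; have [K [h [l pb]]] := hI _ _ _ (over u) (over phi).
have [hX [ht Eh]] := catD_cleavage h X; subst h.
have [fu [El sfu]] := sp_exists pb; subst l.
have [|d [[Ed1 Ed2] _]] := proj2 pb i (idm i) (idm i).
  by rewrite !comp_idr E.
have [|D [ED HD]] := @catD_lift _ _ _ _ _ _ ht (oid _ X) d.
  by rewrite Ed1 over_id.
by exists K, hX, ht, fu, D; split=> //; rewrite ED.
Qed.

(** * Special triangles *)

Variable T : cartesian_structure M.

Lemma sptri_exists (i j k : I) (X : fob M i) (Y : fob M j) (Z : fob M k)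
    (a : ohom (catM M) X Z) (f : ohom (catD M) X Y) (h : hom j k) :
  h ∘ over f = over a ->
  exists b : ohom (catM M) Y Z, over b = h /\ sptri T a b f.
Proof. by move=> /(sptri_opfib T) [b [Eb _]]; exists b. Qed.

Lemma sptri_unique (i j k : I) (X : fob M i) (Y : fob M j) (Z : fob M k)
    (a : ohom (catM M) X Z) (b c : ohom (catM M) Y Z) (f : ohom (catD M) X Y) :
  sptri T a b f -> sptri T a c f -> over b = over c -> b = c.
Proof.
move=> sb sc E; have [x [_ uniq]] := sptri_opfib T (sptri_over sb).
by rewrite -(uniq b) // -(uniq c).
Qed.

(** This is how equations in [catM] arise below: special triangles are composed until their arrow in
    [catD] becomes an identity. *)
Lemma sptri_id_eq (i k : I) (X : fob M i) (Z : fob M k)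
    (a b : ohom (catM M) X Z) : sptri T a b (oid _ X) -> a = b.
Proof.
move=> s; apply: (sptri_unique (sptri_id T a) s).
by rewrite -(sptri_over s) over_id comp_idr.
Qed.

(** * Independence of triangle (ii) from the auxiliary choices *)

(** The comparison [v] of the two kernel pairs is the top of a special square from [fu] to [fu']
    with identity bottom. Frobenius, applied to the identity triangle on [pi], gives a special
    triangle from [pi ∙ fu] to [pi ∙ fu'] along [v], to be composed with the given one. *)
Lemma diagonal_independent (i j k k' : I) (X : fob M i) (P : fob M j)
    (fP : fob M i) (phi : ohom (catD M) fP P) (pi : ohom (catM M) fP X)
    (u : ohom (catM M) X P)
    (hX : fob M k) (ht : ohom (catD M) hX X) (fu : ohom (catM M) hX fP)
    (Delta : ohom (catD M) X hX)
    (hX' : fob M k') (ht' : ohom (catD M) hX' X) (fu' : ohom (catM M) hX' fP)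
    (Delta' : ohom (catD M) X hX') :
  diagonal phi u ht fu Delta -> diagonal phi u ht' fu' Delta' ->
  sptri T (oid _ X) (pi ∙ fu) Delta -> sptri T (oid _ X) (pi ∙ fu') Delta'.
Proof.
move=> [s [E1 E2]] [s' [E1' E2']] tri.
have pb' := sp_pullback s'.
have [v0 [[Ev1 Ev2] _]] := proj2 pb' _ _ _ (proj1 (sp_pullback s)).
have [v [Ev Hv]] := catD_lift Ev1; subst v0.
have sv : sp v (oid _ fP) fu fu'.
  by apply: (sp_cancel s'); rewrite ?Hv ?ocomp_idr // over_id comp_idl.
suff <- : v ∙ Delta = Delta'.
  exact: (sptri_comp tri (sptri_frobenius sv (sptri_id T pi))).
apply: (@catD_ext _ _ _ _ _ _ ht'); last by rewrite ocomp_assoc Hv E2 E2'.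
rewrite over_comp; apply: (pullback_ext pb').
  by rewrite comp_assoc -!over_comp Hv E2 E2'.
by rewrite comp_assoc Ev2 E1 E1'.
Qed.

Lemma algebraic_product_intro (i j k : I) (X : fob M i) (P : fob M j)
    (fP : fob M i) (phi : ohom (catD M) fP P) (pi : ohom (catM M) fP X)
    (u : ohom (catM M) X P) (hX : fob M k)
    (ht : ohom (catD M) hX X) (fu : ohom (catM M) hX fP)
    (Delta : ohom (catD M) X hX) :
  over phi = over u -> over pi = idm i -> sptri T (u ∙ pi) (oid _ P) phi ->
  diagonal phi u ht fu Delta -> sptri T (oid _ X) (pi ∙ fu) Delta ->
  is_algebraic_product T (over u) phi pi u.
Proof.
move=> Ephi Epi tri1 diag tri2; split=> //; split=> //; split=> //; split=> //.
move=> K h l pb hX' ht' Eh fu' El s delta Ed1 Ed2 D ED HD.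
by apply: (diagonal_independent (ht' := ht') diag _ tri2); rewrite /diagonal El ED.
Qed.

Lemma algebraic_product_diagonal (i j k : I) (X : fob M i) (P : fob M j)
    (f : hom i j) (fP : fob M i) (phi : ohom (catD M) fP P)
    (pi : ohom (catM M) fP X) (u : ohom (catM M) X P) (hX : fob M k)
    (ht : ohom (catD M) hX X) (fu : ohom (catM M) hX fP)
    (Delta : ohom (catD M) X hX) :
  is_algebraic_product T f phi pi u -> diagonal phi u ht fu Delta ->
  sptri T (oid _ X) (pi ∙ fu) Delta.
Proof.
move=> [Ephi [_ [Eu [_ tri]]]] [s [E1 E2]].
apply: (tri k (over ht) (over fu) _ hX ht _ fu _ s (over Delta)) => //.
- by move: (sp_pullback s); rewrite Ephi Eu.
- by rewrite -over_comp E2 over_id.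
Qed.

(** * Algebraic and universal products *)

(** This common core yields the counit equation from triangle (ii) alone, so it also serves when
    triangle (i) is still to be proved. The arrow [rho] is pushed forward along a section [e] and
    then along [g], reaching [pi ∙ t'], while [g ∙ e] is an identity. *)
Lemma diagonal_transpose (hI : has_pullbacks I) (i j k m n : I) (X : fob M i)
    (P : fob M j) (fP : fob M i) (phi : ohom (catD M) fP P)
    (pi : ohom (catM M) fP X) (u : ohom (catM M) X P) (hX : fob M k)
    (ht : ohom (catD M) hX X) (fu : ohom (catM M) hX fP)
    (Delta : ohom (catD M) X hX)
    (Q : fob M m) (Q' : fob M n) (phi' : ohom (catD M) Q' Q)
    (rho : ohom (catM M) Q' X)
    (t : ohom (catM M) Q P) (t' : ohom (catM M) Q' fP) :
  over pi = idm i -> diagonal phi u ht fu Delta ->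
  sptri T (oid _ X) (pi ∙ fu) Delta ->
  sp phi' phi t' t -> over t' = over rho -> sptri T (u ∙ rho) t phi' ->
  pi ∙ t' = rho.
Proof.
move=> Epi [s [E1 E2]] tri st Et trit.
(* [W] carries the reindexing [kr] of [rho] along [ht]; stacked on the square of [fu], it reindexes
   [u ∙ rho] along [phi]. *)
have [K [x0 [k0 pbW]]] := hI _ _ _ (over rho) (over ht).
have [W [x Ex]] := catD_cleavage x0 Q'; subst x0.
have [kr [Ek sk]] := sp_exists pbW; subst k0.
have pbt := sp_pullback st.
have [|g0 [[Eg1 Eg2] _]] :=
  proj2 pbt _ (over phi' ∘ over x) (over fu ∘ over kr).
  rewrite !comp_assoc -(proj1 (sp_pullback s)) (sptri_over trit) over_comp.
  by rewrite -!comp_assoc (proj1 pbW).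
have [|g [Eg Hg]] := @catD_lift _ _ _ _ _ _ phi' (phi' ∙ x) g0.
  by rewrite over_comp.
subst g0.
have trig : sptri T (fu ∙ kr) t' g.
  apply: (sptri_beck_chevalley trit (sp_vcomp sk s) st Hg).
  by rewrite over_comp.
(* The section [e] of [x] is the diagonal [Delta] pulled back along [rho]. *)
have [|s0 [[Es1 Es2] _]] := proj2 pbW _ (idm n) (over Delta ∘ over rho).
  by rewrite comp_assoc -over_comp E2 over_id comp_idr comp_idl.
have [|e [Ee He]] := @catD_lift _ _ _ _ _ _ x (oid _ Q') s0.
  by rewrite over_id.
subst s0.
have se : sp e Delta rho kr.
  by apply: (sp_cancel sk) => //; rewrite He E2; apply: sp_hid.
have tri1 := sptri_frobenius se tri.
have tri2 := sptri_postcomp pi trig.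
move: tri1 tri2; rewrite ocomp_idl ocomp_assoc => tri1 tri2.
have := sptri_comp tri1 tri2.
suff -> : g ∙ e = oid _ Q' by move/sptri_id_eq.
apply: (@catD_ext _ _ _ _ _ _ phi').
  rewrite over_comp over_id; apply: (pullback_ext pbt).
    by rewrite comp_assoc Eg1 -comp_assoc Es1.
  by rewrite comp_assoc Eg2 -comp_assoc Es2 comp_assoc E1 comp_idl comp_idr.
by rewrite ocomp_assoc Hg -ocomp_assoc He.
Qed.

Lemma algebraic_product_universal (hI : has_pullbacks I) (i j : I) (X : fob M i)
    (f : hom i j) (P : fob M j) (fP : fob M i) (phi : ohom (catD M) fP P)
    (pi : ohom (catM M) fP X) (u : ohom (catM M) X P) :
  is_algebraic_product T f phi pi u -> is_universal_product f phi pi.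
Proof.
move=> alg; have [Ephi [Epi [Eu [tri _]]]] := alg.
split=> //; split=> // K L f' h' h pb Q Q' phi' Ef' rho Erho; subst f f' h'.
have [k [hX [ht [fu [D diag]]]]] := diagonal_exists hI (eq_sym Eu).
have tri2 := algebraic_product_diagonal alg diag.
have [|t [Et trit]] := @sptri_exists _ _ _ _ _ _ (u ∙ rho) phi' h.
  by rewrite (proj1 pb) over_comp Eu.
subst h.
have [t' [Et' st]] := sp_exists pb.
exists (t, t'); split=> /=.
  by do !split=> //; apply: (diagonal_transpose hI Epi diag tri2 st Et' trit).
move=> [v v'] /= [Ev [Ev' [sv Hv]]].
(* Frobenius on triangle (i) makes [v], like [t], a pushforward of [u ∙ rho] along [phi']. *)
have Etv : t = v.
  apply: (sptri_unique trit) => //.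
  have := sptri_frobenius sv tri.
  by rewrite ocomp_idl -ocomp_assoc Hv.
by subst v; rewrite (sp_unique st sv) // Ev'.
Qed.

Lemma universal_product_algebraic (hI : has_pullbacks I) (i j : I) (X : fob M i)
    (f : hom i j) (P : fob M j) (fP : fob M i) (phi : ohom (catD M) fP P)
    (pi : ohom (catM M) fP X) :
  is_universal_product f phi pi ->
  exists u : ohom (catM M) X P, is_algebraic_product T f phi pi u.
Proof.
move=> [Ephi [Epi univ]]; subst f.
have [K [h [l pb]]] := hI _ _ _ (over phi) (over phi).
have [hX [ht Eh]] := catD_cleavage h X; subst h.
have [|d [[Ed1 Ed2] _]] := proj2 pb i (idm i) (idm i) => //.
have [|D [ED HD]] := @catD_lift _ _ _ _ _ _ ht (oid _ X) d.
  by rewrite Ed1 over_id.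
subst d.
have [|r [Er trir]] := @sptri_exists _ _ _ _ _ _ (oid _ X) D l.
  by rewrite Ed2 over_id.
(* The kernel pair of [over phi] serves as the test square. The component on [X] is the required
   [u], and the factorization of [r] through [pi] is triangle (ii). *)
have [[u fu] /= [[Eu [Efu [su Hu]]] _]] :=
  univ _ _ _ _ _ pb _ _ ht eq_refl r Er.
have diag : diagonal phi u ht fu D by split=> //; rewrite Efu.
rewrite -Hu in trir.
exists u; rewrite -Eu; apply: (algebraic_product_intro _ _ _ diag) => //.
have [|e [Ee trie]] := @sptri_exists _ _ _ _ _ _ (u ∙ pi) phi (idm j).
  by rewrite over_comp Eu Epi comp_idl comp_idr.
have pbid : is_pullback (over phi) (idm i) (idm j) (over phi).
  by have := sp_pullback (sp_vid phi); rewrite !over_id.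
have [|e' [Ee' se]] := @sp_exists _ _ _ _ _ _ _ _ phi phi e (idm i).
  by rewrite Ee.
have He : pi ∙ e' = pi.
  by apply: (diagonal_transpose hI Epi diag trir se _ trie); rewrite Ee'.
(* Both [(e, e')] and the pair of identities correspond to [pi], so [e] is an identity and [trie] is
   triangle (i). *)
have [x [_ uniq]] := univ _ _ _ _ _ pbid _ _ phi eq_refl pi Epi.
have E1 := uniq (e, e') (conj Ee (conj Ee' (conj se He))).
have E2 := uniq (oid _ P, oid _ fP) (conj (over_id _ _) (conj (over_id _ _)
  (conj (sp_vid phi) (ocomp_idr pi)))).
by rewrite E1 in E2; case: E2 => <-.
Qed.

(** * Algebraic products and opcartesian arrows *)

Lemma opcartesian_algebraic_product (hI : has_pullbacks I) (i j : I)
    (X : fob M i) (P : fob M j) (u : ohom (catM M) X P) :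
  opcartesian u -> stably_opcartesian u ->
  exists (fP : fob M i) (phi : ohom (catD M) fP P) (pi : ohom (catM M) fP X),
    is_algebraic_product T (over u) phi pi u.
Proof.
move=> opu stu; have [fP [phi Ephi]] := catD_cleavage (over u) P.
exists fP, phi.
have [k [hX [ht [fu [D diag]]]]] := diagonal_exists hI Ephi.
have [s [E1 E2]] := diag.
have [|r [Er trir]] := @sptri_exists _ _ _ _ _ _ (oid _ X) D (over fu).
  by rewrite E1 over_id.
(* [fu] is a reindexing of [u], hence opcartesian; [r] lies over the same arrow, so it factors
   vertically through [fu]. *)
have [|pi [[Epi Hpi] _]] := stu _ _ _ _ _ _ _ s _ _ r (idm i).
  by rewrite comp_idl Er.
exists pi; rewrite -Hpi in trir.
apply: (algebraic_product_intro _ _ _ diag) => //.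
have [|e [Ee trie]] := @sptri_exists _ _ _ _ _ _ (u ∙ pi) phi (idm j).
  by rewrite over_comp Ephi Epi comp_idl comp_idr.
suff <- : e = oid _ P by [].
(* Push [u] along [D] to [u ∙ pi ∙ fu], then along [ht] to [e ∙ u]; the composite [ht ∙ D] is an
   identity. *)
have Heu : u = e ∙ u.
  apply: sptri_id_eq; rewrite -E2.
  have := sptri_postcomp u trir.
  rewrite ocomp_idr => tri; apply: (sptri_comp tri).
  by rewrite ocomp_assoc; apply: (sptri_frobenius s trie).
have [x [_ uniq]] := opu _ _ u (idm j) (comp_idl _).
by rewrite -(uniq e) // -(uniq (oid _ P)) // over_id ocomp_idl.
Qed.

Lemma algebraic_product_opcartesian (hI : has_pullbacks I) (i j : I)
    (X : fob M i) (f : hom i j) (P : fob M j) (fP : fob M i)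
    (phi : ohom (catD M) fP P) (pi : ohom (catM M) fP X)
    (u : ohom (catM M) X P) :
  is_algebraic_product T f phi pi u -> opcartesian u.
Proof.
move=> alg k Z c w Ew; have [Ephi [Epi [Eu [tri _]]]] := alg; subst f.
have [n [hX [ht [fu [D diag]]]]] := diagonal_exists hI (eq_sym Eu).
have tri2 := algebraic_product_diagonal alg diag.
have [s [E1 E2]] := diag.
have [|b [Eb trib]] := @sptri_exists _ _ _ _ _ _ (c ∙ pi) phi w.
  by rewrite over_comp -Eu Ew Epi comp_idr.
exists b; split.
  (* Pushing [c] along [D] gives [c ∙ pi ∙ fu], and pushing that along [ht] gives [b ∙ u]. *)
  split=> //; apply: eq_sym; apply: sptri_id_eq; rewrite -E2.
  have := sptri_postcomp c tri2; rewrite ocomp_idr => tri3.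
  by apply: (sptri_comp tri3); rewrite ocomp_assoc; apply: (sptri_frobenius s trib).
move=> b' [Eb' Hb']; apply: (sptri_unique trib); last by rewrite Eb.
by have := sptri_postcomp b' tri; rewrite ocomp_idr ocomp_assoc Hb'.
Qed.

(** * Stability of opcartesian arrows under reindexing *)

(** This transfers the structure from a chosen [u] to another arrow [a]. The projection is [pi]
    after the reindexing [w'] of [w], so that [w' ∙ fa] is a reindexing of [u] and triangle (ii) is
    inherited. Triangle (i) comes from that of [u] by Frobenius along [w] and postcomposition with
    [v]. *)
Lemma algebraic_product_retract (hI : has_pullbacks I) (i j : I) (X : fob M i)
    (f : hom i j) (P Y : fob M j) (fP : fob M i) (phi : ohom (catD M) fP P)
    (pi : ohom (catM M) fP X) (u : ohom (catM M) X P) (a : ohom (catM M) X Y)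
    (v : ohom (catM M) P Y) (w : ohom (catM M) Y P) :
  is_algebraic_product T f phi pi u ->
  v ∙ u = a -> w ∙ a = u -> v ∙ w = oid _ Y ->
  over v = idm j -> over w = idm j ->
  exists (fY : fob M i) (phiY : ohom (catD M) fY Y) (piY : ohom (catM M) fY X),
    is_algebraic_product T f phiY piY a.
Proof.
move=> alg Hu Ha Hvw Ev Ew; have [Ephi [Epi [Eu [tri _]]]] := alg.
have [fY [phiY EY]] := catD_cleavage f Y.
have Ea : over a = f by rewrite -Hu over_comp Ev Eu comp_idl.
have [|w' [Ew' sw]] := @sp_exists _ _ _ _ _ _ _ _ phiY phi w (idm i).
  by rewrite EY Ew Ephi; have := sp_pullback (sp_vid phi); rewrite !over_id Ephi.
exists fY, phiY, (pi ∙ w').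
have [|k [hX [ht [fa [D diag]]]]] := @diagonal_exists hI _ _ _ _ _ phiY a.
  by rewrite Ea.
have [s [E1 E2]] := diag.
have diagu : diagonal phi u ht (w' ∙ fa) D.
  split; first by rewrite -Ha; apply: (sp_vcomp s sw).
  by rewrite over_comp Ew' comp_idl.
rewrite -Ea; apply: (algebraic_product_intro _ _ _ diag).
- by rewrite EY.
- by rewrite over_comp Epi Ew' comp_idl.
- have := sptri_postcomp v (sptri_frobenius sw tri).
  by rewrite ocomp_idl Hvw !ocomp_assoc Hu.
- rewrite -ocomp_assoc; exact: (algebraic_product_diagonal alg diagu).
Qed.

Lemma algebraic_product_reindex (hI : has_pullbacks I) (i j i' j' : I)
    (X : fob M i) (Y : fob M j) (f : hom i j) (fY : fob M i)
    (phi : ohom (catD M) fY Y) (pi : ohom (catM M) fY X)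
    (a : ohom (catM M) X Y) (U : fob M i') (V : fob M j')
    (x : ohom (catD M) U X) (y : ohom (catD M) V Y) (b : ohom (catM M) U V) :
  is_algebraic_product T f phi pi a -> sp x y b a ->
  exists (fV : fob M i') (phiV : ohom (catD M) fV V) (piV : ohom (catM M) fV U),
    is_algebraic_product T (over b) phiV piV b.
Proof.
move=> alg sb; have [Ephi [Epi [Ea [tri _]]]] := alg; subst f.
have [fV [phiV EV]] := catD_cleavage (over b) V.
have [|z [Ez Hz]] := @catD_lift _ _ _ _ _ _ phi (y ∙ phiV) (over x).
  by rewrite over_comp EV -Ea (proj1 (sp_pullback sb)).
have [|piV [EpiV spi]] := @sp_exists _ _ _ _ _ _ _ _ z x pi (idm i').
  by rewrite Ez Epi; have := sp_pullback (sp_vid x); rewrite !over_id.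
exists fV, phiV, piV.
have [n [hX [ht [fa [D diag]]]]] := diagonal_exists hI (eq_sym Ea).
have tri2 := algebraic_product_diagonal alg diag.
have [s [E1 E2]] := diag.
have [n' [hU [ht' [fb [D' diag']]]]] := diagonal_exists hI EV.
have [s' [E1' E2']] := diag'.
have pb := sp_pullback s.
(* [y'] compares the two kernel pairs, and makes [fb] a reindexing of [fa] along [z]. *)
have [|y0 [[Ey1 Ey2] _]] := proj2 pb _ (over x ∘ over ht') (over z ∘ over fb).
  rewrite Ea !comp_assoc -over_comp Hz over_comp -Ea (proj1 (sp_pullback sb)).
  by rewrite -!comp_assoc (proj1 (sp_pullback s')).
rewrite -over_comp in Ey1; have [y' [Ey' Hy]] := catD_lift Ey1; subst y0.
have syz : sp y' z fb fa.
  apply: (sp_cancel s); last by rewrite Ey2 Ez.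
  by rewrite Hy Hz; apply: (sp_hcomp s' sb).
apply: (algebraic_product_intro _ _ _ diag') => //.
  apply: (sptri_beck_chevalley tri (sp_vcomp spi sb) (sp_vid y)) => //.
  by rewrite over_id comp_idl over_comp EpiV comp_idr.
(* Compatibility of the diagonals is the condition on arrows of [catD] that Beck-Chevalley requires
   for triangle (ii). *)
have HD : y' ∙ D' = D ∙ x.
  apply: (@catD_ext _ _ _ _ _ _ ht).
    rewrite !over_comp; apply: (pullback_ext pb).
      by rewrite !comp_assoc -!over_comp Hy E2 -ocomp_assoc E2' ocomp_idl ocomp_idr.
    by rewrite !comp_assoc Ey2 -comp_assoc E1' E1 Ez comp_idl comp_idr.
  by rewrite !ocomp_assoc Hy E2 -ocomp_assoc E2' ocomp_idl ocomp_idr.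
apply: (sptri_beck_chevalley tri2 (sp_vid x) (sp_vcomp syz spi) HD).
by rewrite over_comp EpiV comp_idl E1' over_id.
Qed.

Lemma opcartesian_stably (hI : has_pullbacks I) :
  has_algebraic_products T ->
  forall (i j : I) (X : fob M i) (Y : fob M j) (a : ohom (catM M) X Y),
    opcartesian a -> stably_opcartesian a.
Proof.
move=> alg i j X Y a opa.
have [P [fP [phi [pi [u algu]]]]] := alg i X j (over a).
have opu := algebraic_product_opcartesian hI algu.
have Eu : over u = over a by case: algu => [_ [_ []]].
(* [u] and [a] are opcartesian over the same arrow with the same domain, so each factors vertically
   through the other. *)
have [|v [[Ev Hv] _]] := opu _ _ a (idm j); first by rewrite comp_idl Eu.
have [|w [[Ew Hw] _]] := opa _ _ u (idm j); first by rewrite comp_idl Eu.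
have Hvw : v ∙ w = oid _ Y.
  have [x [_ uniq]] := opa _ _ a (idm j) (comp_idl _).
  have <- : x = oid _ Y by apply: uniq; rewrite over_id ocomp_idl.
  by apply: eq_sym; apply: uniq; rewrite over_comp Ev Ew comp_idl -ocomp_assoc Hw Hv.
have [fY [phiY [piY alga]]] :=
  algebraic_product_retract hI algu Hv Hw Hvw Ev Ew.
move=> k l U V x y b sb.
have [fV [phiV [piV algb]]] := algebraic_product_reindex hI alga sb.
exact: (algebraic_product_opcartesian hI algb).
Qed.

End FiberedMulticategory.

Theorem theorem4p11 (I : category) (hI : has_pullbacks I)
    (M : fibered_multicategory I) (T : cartesian_structure M) :
  (has_algebraic_products T <-> has_universal_products M) /\
  (has_universal_products M <-> stably_representable M).
Proof.
have alg_univ : has_algebraic_products T -> has_universal_products M.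
  move=> alg i X j f; have [P [fP [phi [pi [u algu]]]]] := alg i X j f.
  by exists P, fP, phi, pi; apply: (algebraic_product_universal hI algu).
have univ_alg : has_universal_products M -> has_algebraic_products T.
  move=> univ i X j f; have [P [fP [phi [pi univP]]]] := univ i X j f.
  have [u algu] := universal_product_algebraic T hI univP.
  by exists P, fP, phi, pi, u.
have alg_rep : has_algebraic_products T -> stably_representable M.
  move=> alg; split; last exact: (opcartesian_stably hI alg).
  move=> i j f X; have [P [fP [phi [pi [u algu]]]]] := alg i X j f.
  exists P, u; split; last exact: (algebraic_product_opcartesian hI algu).
  by case: algu => [_ [_ []]].
have rep_alg : stably_representable M -> has_algebraic_products T.
  move=> [rep stab] i X j f; have [P [u [Eu opu]]] := rep i j f X; subst f.
  have [fP [phi [pi algu]]] :=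
    opcartesian_algebraic_product T hI opu (stab _ _ _ _ _ opu).
  by exists P, fP, phi, pi, u.
by split; split; auto.
Qed.
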